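(* Let $A$ be a unital $C^*$-algebra and let $B\subseteq A$ be a $C^*$-subalgebra containing the identity of $A$. Let $\mathcal{H}$ be the universal bimodule over $A$. (a) $(A,B)$ has property $(T)$ if and only if for any unital Hilbert bimodule $H$ over $A$, the existence of an almost central unit vector for $A$ in $H$ implies that $H^B\neq\{0\}$. (b) The following statements are equivalent. (i) $(A,B)$ has strong property $(T)$. (ii) For any almost central unit vector $(\xi_i)_{i\in I}$ for $A$ in any unital Hilbert bimodule $H$ over $A$, we have $\|\xi_i-P^B_H(\xi_i)\|\to 0$. (iii) For any almost central unit vector $(\xi_i)_{i\in I}$ for $A$ in $\mathcal{H}$ and any $n\in\mathbb{N}$, there exists $i_n\in I$ with $\|\xi_{i_n}-P^B_{\mathcal{H}}(\xi_{i_n})\|<1/n$.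
   Context: Let $A^{Dou}:=A\otimes_{\max}A^{\rm op}$, where $A^{\rm op}$ is the opposite $C^*$-algebra. A unital Hilbert bimodule over $A$ is a Hilbert space $H$ with commuting unital left and right actions of $A$ coming from a non-degenerate $*$-representation of $A^{Dou}$, with $(a\otimes b^{\rm op})\xi=a\cdot\xi\cdot b$. For such $H$, $H^B:=\{\xi\in H: b\cdot\xi=\xi\cdot b\text{ for all }b\in B\}$ and $P^B_H:H\to H^B$ is the orthogonal projection. For a non-empty finite $Q\subseteq A$ and $\beta>0$, $V_H(Q,\beta):=\{\xi\in H:\|\xi\|=1,\ \|x\cdot\xi-\xi\cdot x\|<\beta\text{ for all }x\in Q\}$. An almost central unit vector for $A$ in $H$ is a net $(\xi_i)_{i\in I}$ of unit vectors of $H$ with $\|a\cdot\xi_i-\xi_i\cdot a\|\to 0$ for every $a\in A$. The pair $(A,B)$ has property $(T)$ if there exist a non-empty finite $F\subseteq A$ and $\epsilon>0$ such that for any unital Hilbert bimodule $H$ over $A$, $V_H(F,\epsilon)\neq\emptyset$ implies $H^B\neq\{0\}$. The pair $(A,B)$ has strong property $(T)$ if for any $\alpha>0$ there exist a non-empty finite $Q\subseteq A$ and $\beta>0$ such that for any unital Hilbert bimodule $H$ over $A$ and any $\xi\in V_H(Q,\beta)$, $\|\xi-P^B_H(\xi)\|<\alpha$. The universal bimodule over $A$ is $\mathcal{H}:=\bigoplus_{\tau\in S(A^{Dou})}M_\tau$, where $S(A^{Dou})$ is the state space of $A^{Dou}$ and $M_\tau$ is the GNS representation of $\tau$, viewed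 as a bimodule over $A$. *)

(* Defs.v *)
From HB Require Import structures.
From mathcomp Require Import all_boot all_order all_algebra.
From mathcomp Require Import complex.
From mathcomp Require Import all_classical all_reals all_analysis.

Set Implicit Arguments.
Unset Strict Implicit.
Unset Printing Implicit Defensive.

Import Order.TTheory GRing.Theory Num.Theory Num.Def.
Import numFieldNormedType.Exports.

Local Open Scope classical_set_scope.
Local Open Scope ring_scope.

(* The complex numbers are R[i] for R : realType.  Norms of complex normed
   modules take values in R[i], whose order is partial: [0 < e] in R[i] says
   that e is a positive real number. *)

(* {dot H for conjC} is a positive definite form which is linear in its first
   argument and conjugate-linear in its second one. *)
HB.mixin Record isHilbert (R : realType) H & CompleteNormedModule R[i] H := {
  hdot : {dot H for (@conjC R[i])} ;
  hdot_norm : forall u : H, hdot u u = `|u| ^+ 2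
}.

#[short(type="hilbertType")]
HB.structure Definition Hilbert (R : realType) :=
  {H of CompleteNormedModule R[i] H & isHilbert R H}.

(* Unital C*-algebras.  The product is a field of the structure because the
   hierarchy has no join of rings and normed modules (other than numeric
   domains), and one cannot be added from outside the library.
   The zero algebra is not excluded. *)
HB.mixin Record isCStar (R : realType) A & CompleteNormedModule R[i] A := {
  cmul : {bilinear A -> A -> A} ;
  cone : A ;
  cmulA : forall x y z : A, cmul x (cmul y z) = cmul (cmul x y) z ;
  cmul1x : forall x : A, cmul cone x = x ;
  cmulx1 : forall x : A, cmul x cone = x ;
  star : A -> A ;
  star_antilinear : forall (c : R[i]) (x y : A),
    star (c *: x + y) = c^* *: star x + star y ;
  starK : forall x : A, star (star x) = x ;
  starM : forall x y : A, star (cmul x y) = cmul (star y) (star x) ;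
  norm_cmul : forall x y : A, `|cmul x y| <= `|x| * `|y| ;
  norm_cstar : forall x : A, `|cmul (star x) x| = `|x| ^+ 2
}.

#[short(type="cstarType")]
HB.structure Definition CStar (R : realType) :=
  {A of CompleteNormedModule R[i] A & isCStar R A}.

Definition cstar_subalgebra (R : realType) (A : cstarType R) (B : set A) :
    Prop :=
  [/\ B 0,
      forall (c : R[i]) (x y : A), B x -> B y -> B (c *: x + y),
      forall x y : A, B x -> B y -> B (cmul x y),
      forall x : A, B x -> B (star x)
    & closed B].

Definition opalg (A : Type) : Type := A.

Definition op (A : Type) (a : A) : opalg A := a.

Section OppositeAlgebra.
Variables (R : realType) (A : cstarType R).

HB.instance Definition _ := CompleteNormedModule.copy (opalg A) A.

Definition op_mul (x y : opalg A) : opalg A := cmul (y : A) (x : A).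

Fact op_mul_linear_r (x : opalg A) : linear (op_mul x).
Proof. by move=> c y z; rewrite /op_mul linearPl. Qed.

Fact op_mul_linear_l (y : opalg A) : linear (op_mul ^~ y).
Proof. by move=> c x z; rewrite /op_mul linearPr. Qed.

HB.instance Definition _ := bilinear_isBilinear.Build R[i] (opalg A) (opalg A)
  (opalg A) *:%R *:%R op_mul (op_mul_linear_l, op_mul_linear_r).

Fact norm_star (x : A) : `|star x| = `|x|.
Proof.
have le_star (y : A) : `|y| <= `|star y|.
  have [->|y0] := eqVneq y 0; first by rewrite normr0 normr_ge0.
  have := norm_cmul (star y) y; rewrite norm_cstar expr2.
  by rewrite ler_pM2r ?normr_gt0.
by apply/le_anti; rewrite le_star -{2}(starK x) le_star.
Qed.

Fact op_norm_cstar (x : opalg A) :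
  `|op_mul (star (x : A)) x| = `|x| ^+ 2.
Proof.
have -> : `|x| = `|star (x : A)| by rewrite norm_star.
by rewrite -norm_cstar starK.
Qed.

Fact op_norm_mul (x y : opalg A) : `|op_mul x y| <= `|x| * `|y|.
Proof. by rewrite mulrC; exact: (@norm_cmul R A). Qed.

HB.instance Definition _ := @isCStar.Build R (opalg A)
  op_mul (cone : A)
  (fun x y z => esym (@cmulA R A z y x))
  (@cmulx1 R A) (@cmul1x R A)
  (@star R A) (@star_antilinear R A) (@starK R A)
  (fun x y => @starM R A y x)
  op_norm_mul op_norm_cstar.

End OppositeAlgebra.

Definition lspan (K : numFieldType) (V : lmodType K) (S : set V) : set V :=
  [set v | exists s : seq (K * V),
     (forall p, p \in s -> S p.2) /\ v = \sum_(p <- s) p.1 *: p.2].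

Section Representations.
Variable R : realType.

(* Linear maps with values in the bounded operators of H, compatible with
   products and adjoints. *)
Record star_rep (D : cstarType R) (H : hilbertType R) := StarRep {
  rep :> D -> {linear H -> H} ;
  rep_bounded : forall d, continuous (rep d) ;
  rep_linear : forall (c : R[i]) (d e : D) (xi : H),
    rep (c *: d + e) xi = c *: rep d xi + rep e xi ;
  rep_mul : forall (d e : D) (xi : H), rep (cmul d e) xi = rep d (rep e xi) ;
  rep_star : forall (d : D) (xi eta : H),
    hdot (rep d xi) eta = hdot xi (rep (star d) eta)
}.

Definition nondegenerate_rep (D : cstarType R) (H : hilbertType R)
    (pi : star_rep D H) : Prop :=
  dense (lspan [set zeta | exists d xi, zeta = pi d xi]).

(* *-homomorphisms from the algebraic tensor product of A and B to the bounded
   operators of H, given by their values sigma a b on elementary tensors. *)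
Record tensor_rep (A B : cstarType R) (H : hilbertType R) := TensorRep {
  trep :> A -> B -> {linear H -> H} ;
  trep_bounded : forall a b, continuous (trep a b) ;
  trep_linear_l : forall (c : R[i]) (a a' : A) (b : B) (xi : H),
    trep (c *: a + a') b xi = c *: trep a b xi + trep a' b xi ;
  trep_linear_r : forall (c : R[i]) (a : A) (b b' : B) (xi : H),
    trep a (c *: b + b') xi = c *: trep a b xi + trep a b' xi ;
  trep_mul : forall (a a' : A) (b b' : B) (xi : H),
    trep (cmul a a') (cmul b b') xi = trep a b (trep a' b' xi) ;
  trep_star : forall (a : A) (b : B) (xi eta : H),
    hdot (trep a b xi) eta = hdot xi (trep (star a) (star b) eta)
}.

(* The maximal tensor product, up to isomorphism: the completion of the
   algebraic tensor product for the norm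
     |x|_max = sup { |sigma x| : sigma a *-representation of A (x) B }.
   The field max_norm states that the norm is this supremum (the least upper
   bound, with the operator norms spelled out). *)
Record max_tensor (A B : cstarType R) := MaxTensor {
  max_alg :> cstarType R ;
  tens : {bilinear A -> B -> max_alg} ;
  tens_mul : forall (a a' : A) (b b' : B),
    cmul (tens a b) (tens a' b') = tens (cmul a a') (cmul b b') ;
  tens_star : forall (a : A) (b : B), star (tens a b) = tens (star a) (star b) ;
  tens_dense : dense (lspan [set t | exists a b, t = tens a b]) ;
  max_norm : forall (s : seq (A * B)) (M : R[i]), 0 <= M ->
    (`|\sum_(p <- s) tens p.1 p.2| <= M) <->
    (forall (H : hilbertType R) (sigma : tensor_rep A B H) (xi : H),
       `|\sum_(p <- s) sigma p.1 p.2 xi| <= M * `|xi|)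
}.

(* For a positive functional on a unital C*-algebra, tau 1 = 1 is the usual
   form of the normalization |tau| = 1. *)
Record state (D : cstarType R) := State {
  state_fun :> {scalar D} ;
  state_pos : forall d : D, 0 <= state_fun (cmul (star d) d) ;
  state_one : state_fun cone = 1
}.

End Representations.

Section Bimodules.
Variables (R : realType) (A : cstarType R) (Dou : max_tensor A (opalg A)).

(* Unitality of the two actions is a consequence of non-degeneracy. *)
Record bimodule := Bimodule {
  bm_space :> hilbertType R ;
  bm_rep : star_rep Dou bm_space ;
  bm_nondegenerate : nondegenerate_rep bm_rep
}.

Definition lact (H : bimodule) (a : A) (xi : H) : H :=
  bm_rep H (tens Dou a (op cone)) xi.

Definition ract (H : bimodule) (xi : H) (b : A) : H :=
  bm_rep H (tens Dou cone (op b)) xi.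

Definition central (H : bimodule) (B : set A) : set H :=
  [set xi | forall b, B b -> lact b xi = ract xi b].
Arguments central : clear implicits.

(* The orthogonal projection onto the closed subspace [central H B]. *)
Definition central_proj (B : set A) (H : bimodule) (xi : H) : H :=
  xget 0 [set p | central H B p /\
                  forall eta, central H B eta -> hdot (xi - p) eta = 0].

Definition almost_central_set (H : bimodule) (Q : set A) (beta : R[i]) :
    set H :=
  [set xi | `|xi| = 1 /\
            forall x, Q x -> `|lact x xi - ract xi x| < beta].
Arguments almost_central_set : clear implicits.

Definition property_T (B : set A) : Prop :=
  exists (F : set A) (eps : R[i]),
    [/\ finite_set F, F !=set0, 0 < eps &
        forall H : bimodule,
          almost_central_set H F eps !=set0 -> central H B <> [set 0]].

Definition strong_property_T (B : set A) : Prop :=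
  forall alpha : R[i], 0 < alpha ->
  exists (Q : set A) (beta : R[i]),
    [/\ finite_set Q, Q !=set0, 0 < beta &
        forall (H : bimodule) (xi : H),
          almost_central_set H Q beta xi -> `|xi - central_proj B xi| < alpha].

(* The GNS representation of tau, which is determined up to unitary
   equivalence by its cyclic vector xi. *)
Definition is_GNS (tau : state Dou) (M : bimodule) : Prop :=
  exists xi : M,
    (forall d : Dou, hdot (bm_rep M d xi) xi = tau d) /\
    dense [set eta | exists d : Dou, eta = bm_rep M d xi].

(* H is the Hilbert space direct sum of the bimodules M i, where inc i is the
   inclusion of the summand M i. *)
Definition is_direct_sum (I : Type) (M : I -> bimodule) (H : bimodule) : Prop :=
  exists inc : forall i, {linear M i -> H},
    [/\ forall i (xi eta : M i), hdot (inc i xi) (inc i eta) = hdot xi eta,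
        forall i j (xi : M i) (eta : M j), i <> j ->
          hdot (inc i xi) (inc j eta) = 0,
        forall i (d : Dou) (xi : M i),
          inc i (bm_rep (M i) d xi) = bm_rep H d (inc i xi)
      & dense (lspan [set zeta | exists i (xi : M i), zeta = inc i xi])].

Definition is_universal_bimodule (H : bimodule) : Prop :=
  exists M : state Dou -> bimodule,
    (forall tau, is_GNS tau (M tau)) /\ is_direct_sum M H.

End Bimodules.

Arguments central {R A Dou} H B.
Arguments almost_central_set {R A Dou} H Q beta.

Definition directed (I : Type) (le : I -> I -> Prop) : Prop :=
  [/\ inhabited I,
      forall i, le i i,
      forall i j k, le i j -> le j k -> le i k
    & forall i j, exists k, le i k /\ le j k].

(* The filter of a net: [f @ tails le --> l] is convergence of the net f. *)
Definition tails (I : Type) (le : I -> I -> Prop) : set_system I :=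
  [set S | exists i0, forall i, le i0 i -> S i].

(* R[i]^o is R[i] with its topology as a normed module over itself. *)
Definition net_cvg0 (R : realType) (I : Type) (le : I -> I -> Prop)
    (f : I -> R[i]) : Prop :=
  f @ tails le --> (0 : R[i]^o).

Definition almost_central_unit_vector (R : realType) (A : cstarType R)
    (Dou : max_tensor A (opalg A)) (H : bimodule Dou)
    (I : Type) (le : I -> I -> Prop) (xi : I -> H) : Prop :=
  [/\ directed le,
      forall i, `|xi i| = 1
    & forall a : A, net_cvg0 le (fun i => `|lact a (xi i) - ract (xi i) a|)].

(* Main.v *)
(* Everything is reduced to cyclic subbimodules.  If xi is a unit vector of a
   bimodule H, the GNS bimodule M of its vector state sits isometrically both in
   H, with its cyclic vector sent to xi, and in the universal bimodule.  An
   isometric intertwiner T : E -> H preserves the almost centrality of vectors,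
   and also their distance to the central vectors: the projection of a central
   vector onto T(E) is again central.  Hence a failure of strong property (T) in
   arbitrary bimodules is seen on vectors of the universal bimodule, where the
   pairs (finite subset of A, tolerance) index a net contradicting (iii).
   For (a), the vectors of the universal bimodule which are orthogonal to the
   subbimodule generated by the central vectors form a bimodule K with
   K^B = 0; it contains every cyclic bimodule without central vectors, so a
   failure of property (T) yields an almost central net in K.  This replaces the
   direct sum of the bimodules that witness the failure. *)
From HB Require Import structures.
Require Import Defs.
From mathcomp Require Import all_boot all_order all_algebra.
From mathcomp Require Import complex ring.
From mathcomp Require Import all_classical all_reals all_analysis.

Import Order.TTheory GRing.Theory Num.Theory.
Import numFieldNormedType.Exports.
Local Open Scope classical_set_scope.
Local Open Scope ring_scope.

Set Implicit Arguments.
Unset Strict Implicit.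
Unset Printing Implicit Defensive.

(** * Order arguments on complex numbers, reduced to positive reals *)

Section ComplexOrder.
Variable R : realType.
Implicit Types e x : R[i].

Lemma invSn_gt0 n : 0 < n.+1%:R^-1 :> R[i].
Proof. by rewrite invr_gt0 ltr0n. Qed.

Lemma invSn_le m n : (m <= n)%N -> n.+1%:R^-1 <= m.+1%:R^-1 :> R[i].
Proof. by move=> mn; rewrite lef_pV2 ?posrE ?ltr0n// ler_nat. Qed.

Lemma invSn_lt e : 0 < e -> exists n, n.+1%:R^-1 < e.
Proof.
move=> e0; have eR : (complex.Re e)%:C%C = e by rewrite RRe_real ?gtr0_real.
have Re0 : 0 < complex.Re e by rewrite -ltcR eR.
exists (Num.truncn (complex.Re e)^-1).
rewrite -eR -[_.+1%:R](rmorph_nat (real_complex R)) -fmorphV ltcR.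
by rewrite invf_plt ?posrE ?ltr0n// truncnS_gt.
Qed.

Lemma eq0_lt x : 0 <= x -> (forall e, 0 < e -> x < e) -> x = 0.
Proof.
by rewrite le_eqVlt => /predU1P[//|x0] /(_ x x0); rewrite ltxx.
Qed.

Lemma min_pos (a b : R[i]) : 0 < a -> 0 < b ->
  exists c, [/\ 0 < c, c <= a & c <= b].
Proof.
move=> a0 b0; have /orP[ab|ba] := real_leVge (gtr0_real a0) (gtr0_real b0).
  by exists a.
by exists b.
Qed.

(** Nonnegative elements of [R[i]] are real, so the infimum can be taken over their real parts; [i0]
    makes the range nonempty. *)
Lemma infC (I : Type) (f : I -> R[i]) (i0 : I) : (forall i, 0 <= f i) ->
  exists D, [/\ 0 <= D, forall i, D <= f i &
    forall e, 0 < e -> exists i, f i < D + e].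
Proof.
move=> f0; pose g i := complex.Re (f i).
have fE i : f i = (g i)%:C%C by rewrite RRe_real ?ger0_real.
have g0 i : 0 <= g i by rewrite -lecR -fE.
have ginf : has_inf (range g).
  by split; [exists (g i0), i0|exists 0 => _ [i _ <-]].
exists (inf (range g))%:C%C; split.
- rewrite -[0]/(0%:C%C) lecR; apply: lb_le_inf; first by exists (g i0), i0.
  by move=> _ [i _ <-].
- move=> i; rewrite fE lecR; apply: ge_inf; last by exists i.
  by exists 0 => _ [j _ <-].
- move=> e e0; have eR : (complex.Re e)%:C%C = e by rewrite RRe_real ?gtr0_real.
  have Re0 : 0 < complex.Re e by rewrite -ltcR eR.
  have [_ [i _ <-] gi] := inf_adherent Re0 ginf.
  by exists i; rewrite fE -eR -rmorphD/= ltcR.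
Qed.

End ComplexOrder.

(** * Density, continuity and completeness in terms of norms *)

Section NormedModules.
Variables (K : numFieldType).

Lemma closure_normP (V : normedModType K) (S : set V) (x : V) :
  closure S x <-> forall e : K, 0 < e -> exists2 y, S y & `|x - y| < e.
Proof.
split=> [Sx e e0|Sx B].
  have [y [Sy]] := Sx _ (nbhsx_ballx x e e0).
  by rewrite -ball_normE; exists y.
move=> /nbhs_ballP[e /= e0 xeB]; have [y Sy xy] := Sx e e0.
by exists y; split=> //; apply: xeB; rewrite -ball_normE.
Qed.

Lemma dense_norm (V : normedModType K) (S : set V) : dense S ->
  forall x (e : K), 0 < e -> exists2 y, S y & `|x - y| < e.
Proof.
move=> dS x; apply/closure_normP => B /nbhs_ballP[e /= e0 xeB].
have [|y [yB Sy]] := dS (ball x e)^°%classic _ (@open_interior _ _).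
  by exists x; exact: nbhsx_ballx.
by exists y; split=> //; apply: xeB; exact: interior_subset yB.
Qed.

Lemma closed_eq_fun (V W : normedModType K) (f g : V -> W) :
  continuous f -> continuous g -> closed [set x | f x = g x].
Proof.
move=> fc gc.
have -> : [set x | f x = g x] = (fun x => f x - g x) @^-1` [set 0].
  apply/seteqP; split=> x /=; first by move=> ->; rewrite subrr.
  by move/eqP; rewrite subr_eq0 => /eqP.
apply: preimage_closed.
  by move=> x _; apply: continuousB; [exact: fc|exact: gc].
exact/accessible_closed_set1/hausdorff_accessible/norm_hausdorff.
Qed.

Lemma continuous_norm (V W : normedModType K) (f : V -> W) :
  (forall e, 0 < e ->
    exists2 c, 0 < c & forall x y, `|x - y| < c -> `|f x - f y| < e) ->
  continuous f.
Proof.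
move=> fP x; apply/cvgrPdist_lt => e /fP[c c0 Hc]; apply/nbhs_ballP.
by exists c => // y; rewrite -ball_normE; exact: Hc.
Qed.

End NormedModules.

(** Cantor's intersection argument: any selection [u n] from [B n] is Cauchy. The sets are not
    closed, so the limit may lie outside them and is only approximated by their points. *)
Lemma nested_cvg (R : realType) (V : completeNormedModType R[i])
    (B : nat -> set V) :
  (forall n, B n !=set0) ->
  (forall m n, (m <= n)%N -> B n `<=` B m) ->
  (forall e : R[i], 0 < e ->
    exists n, forall x y, B n x -> B n y -> `|x - y| < e) ->
  exists l, forall e : R[i], 0 < e -> exists n, forall x, B n x -> `|l - x| < e.
Proof.
move=> Bneq0 Bmono Bsmall.
have [u Bu] := choice Bneq0.
have /cauchy_cvg/cvg_ex[l ul] : cauchy (u @ \oo).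
  apply/cauchy_exP => e e0; have [n Bn] := Bsmall e e0.
  exists (u n); exists n => // m /= nm; rewrite -ball_normE /=.
  by apply: Bn => //; apply: (Bmono n m).
exists l => e e0; have e20 : 0 < e / 2 by rewrite divr_gt0.
have [n Bn] := Bsmall _ e20; exists n => x Bx.
have [m _ um] : \forall m \near \oo, `|l - u m| < e / 2.
  by move/cvgrPdist_lt : ul; apply.
rewrite -(subrK (u (maxn m n)) l) -addrA [e]splitr.
apply: (le_lt_trans (ler_normD _ _)); apply: ltrD.
  by apply: um; rewrite /= leq_maxl.
by apply: Bn => //; apply: Bmono (leq_maxr m n) _ _.
Qed.

(** * Closed subspaces as Hilbert spaces *)

Definition closed_submodule (K : numFieldType) (V : normedModType K)
    (S : set V) : Prop :=
  [/\ S 0, forall (c : K) x y, S x -> S y -> S (c *: x + y) & closed S].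

(** Bundled with its closedness proof, so that the instances on [hsub S] depend on the parameter [S]
    alone. *)
Record subspace_of (R : realType) (H : hilbertType R) := SubspaceOf {
  subspace_set :> H -> Prop ;
  subspace_closed : closed_submodule (subspace_set : set H)
}.

Section ClosedSubspace.
Variables (R : realType) (H : hilbertType R) (S : subspace_of H).

Definition subspace_pred : {pred H} := fun x => `[< S x >].

Fact subspace_submod_closed : subsemimod_closed subspace_pred.
Proof.
have [S0 Slin _] := subspace_closed S.
split; first split.
- exact/asboolP.
- move=> x y /asboolP Sx /asboolP Sy; apply/asboolP.
  by rewrite -[x]scale1r; apply: Slin.
- move=> c x /asboolP Sx; apply/asboolP.
  by rewrite -[_ *: _]addr0; apply: Slin.
Qed.

HB.instance Definition _ :=
  GRing.isSubmodClosed.Build R[i] H subspace_pred subspace_submod_closed.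

Record hsub := HSub { hsub_val :> H ; _ : hsub_val \in subspace_pred }.

HB.instance Definition _ := [isSub for hsub_val].
HB.instance Definition _ := [Choice of hsub by <:].
HB.instance Definition _ := [SubChoice_isSubLmodule of hsub by <:].

Lemma hsubP (x : hsub) : S (val x).
Proof. exact: (asboolP _ (valP x)). Qed.

Definition hsub_norm (x : hsub) : R[i] := `|val x|.

Fact hsub_normD x y : hsub_norm (x + y) <= hsub_norm x + hsub_norm y.
Proof. by rewrite /hsub_norm raddfD ler_normD. Qed.

Fact hsub_normZ (c : R[i]) x : hsub_norm (c *: x) = `|c| * hsub_norm x.
Proof. by rewrite /hsub_norm linearZ /= normrZ. Qed.

Fact hsub_norm0_eq0 x : hsub_norm x = 0 -> x = 0.
Proof. by move=> /normr0_eq0 x0; apply: val_inj; rewrite x0 raddf0. Qed.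

HB.instance Definition _ := Lmodule_isNormed.Build R[i] hsub
  hsub_normD hsub_normZ hsub_norm0_eq0.

Lemma hsub_normE (x : hsub) : `|x| = `|val x|. Proof. by []. Qed.

Fact hsub_complete (F : set_system hsub) : ProperFilter F -> cauchy F -> cvg F.
Proof.
move=> FF Fcauchy.
have /cauchy_cvg/cvg_ex[l Fl] : cauchy (val @ F : set_system H).
  apply/cauchy_exP => e e0.
  have /cauchyP /(_ e e0)[x Fx] := Fcauchy.
  exists (val x); rewrite nbhs_simpl /=; apply: filterS Fx => y.
  by rewrite /= -!ball_normE /ball_ /= -[hsub_val x - _](raddfB val).
have Sl : l \in subspace_pred.
  apply/asboolP; have [_ _ Scl] := subspace_closed S.
  apply: (closed_cvg _ Scl _ _ Fl).
  by apply: nearW => x; exact: hsubP.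
apply/cvg_ex; exists (HSub Sl); apply/cvgrPdist_lt => e e0.
move/cvgrPdist_lt : Fl => /(_ e e0); apply: filterS => x.
by rewrite -[l - _](raddfB val (HSub Sl)).
Qed.

HB.instance Definition _ := Uniform_isComplete.Build hsub hsub_complete.

Definition hsub_dot (x y : hsub) : R[i] := hdot (val x) (val y).

Fact hsub_dot_bilinear : bilinear_for
  (GRing.Scale.Law.clone _ _ *%R _)
  (GRing.Scale.Law.clone _ _ (Num.conj \; *%R) _) hsub_dot.
Proof.
split=> [y c x x'|y c x x'] /=.
- by rewrite /hsub_dot linearP linearPl.
- by rewrite /hsub_dot (linearP val) linearPr.
Qed.

HB.instance Definition _ := bilinear_isBilinear.Build R[i] hsub hsub R[i]
  (GRing.Scale.Law.clone _ _ *%R _)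
  (GRing.Scale.Law.clone _ _ (Num.conj \; *%R) _)
  hsub_dot hsub_dot_bilinear.

Fact hsub_dot_herm x y :
  hsub_dot x y = (-1) ^+ false * Num.conj (hsub_dot y x).
Proof. exact: hermC. Qed.

HB.instance Definition _ := isHermitianSesquilinear.Build R[i] hsub false
  Num.conj hsub_dot hsub_dot_herm.

Fact hsub_dot_gt0 (x : hsub) : x != 0 -> 0 < hsub_dot x x.
Proof. by move=> x0; apply: neq0_dnorm_gt0. Qed.

HB.instance Definition _ := isDotProduct.Build R[i] hsub hsub_dot hsub_dot_gt0.

Fact hsub_dot_norm (x : hsub) : hsub_dot x x = `|x| ^+ 2.
Proof. exact: hdot_norm. Qed.

HB.instance Definition _ := isHilbert.Build R hsub hsub_dot_norm.

End ClosedSubspace.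

(** * Hilbert space geometry: Cauchy-Schwarz, adjoints of isometries, projections, polarization *)

Section HilbertGeometry.
Variables (R : realType) (H : hilbertType R).
Implicit Types x y z : H.

Lemma hdotC x y : hdot x y = Num.conj (hdot y x).
Proof. by rewrite hermC expr0 mul1r. Qed.

Lemma hdot_eq0C x y : hdot x y = 0 -> hdot y x = 0.
Proof. by move=> xy; rewrite hdotC xy conjC0. Qed.

Lemma hdot_self_eq0 x : hdot x x = 0 -> x = 0.
Proof. by move/eqP; rewrite dnorm_eq0 => /eqP. Qed.

Lemma hdotDl x y z : hdot (x + y) z = hdot x z + hdot y z.
Proof. exact: linearDl. Qed.

Lemma hdotBl x y z : hdot (x - y) z = hdot x z - hdot y z.
Proof. exact: linearBl. Qed.

Lemma hdotZl c x y : hdot (c *: x) y = c * hdot x y.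
Proof. exact: linearZl_LR. Qed.

Lemma hdotDr x y z : hdot x (y + z) = hdot x y + hdot x z.
Proof. exact: linearDr. Qed.

Lemma hdotBr x y z : hdot x (y - z) = hdot x y - hdot x z.
Proof. exact: linearBr. Qed.

Lemma hdotZr c x y : hdot x (c *: y) = Num.conj c * hdot x y.
Proof. exact: linearZr_LR. Qed.

Lemma hdot0l y : hdot 0 y = 0.
Proof. exact: linear0l. Qed.

Lemma hdot0r x : hdot x 0 = 0.
Proof. exact: linear0r. Qed.

Lemma hdotNl x y : hdot (- x) y = - hdot x y.
Proof. exact: linearNl. Qed.

Lemma hdotNr x y : hdot x (- y) = - hdot x y.
Proof. exact: linearNr. Qed.

Definition hdotE := (hdotDl, hdotNl, hdotZl, hdotDr, hdotNr, hdotZr).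

(* Squared distance from [x] to the line of [y]. *)
Lemma hnorm_sub_line x y : y != 0 ->
  `|x - hdot x y / `|y| ^+ 2 *: y| ^+ 2
    = `|x| ^+ 2 - `|hdot x y| ^+ 2 / `|y| ^+ 2.
Proof.
move=> y0; have ny0 : `|y| ^+ 2 != 0 by rewrite expf_neq0 ?normr_eq0.
rewrite -!hdot_norm in ny0 *; rewrite !hdotE [hdot y x]hdotC normCK.
rewrite rmorphM fmorphV /= -(hdotC y y); field.
exact: ny0.
Qed.

Lemma cauchy_schwarz x y : `|hdot x y| <= `|x| * `|y|.
Proof.
have [->|y0] := eqVneq y 0; first by rewrite hdot0r !normr0 mulr0.
have y2 : 0 < `|y| ^+ 2 by rewrite exprn_gt0 ?normr_gt0.
rewrite -ler_sqr ?nnegrE ?mulr_ge0 // exprMn -ler_pdivrMr // -subr_ge0.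
by rewrite -hnorm_sub_line // exprn_ge0.
Qed.

Lemma parallelogram x y :
  `|x + y| ^+ 2 + `|x - y| ^+ 2 = 2 * `|x| ^+ 2 + 2 * `|y| ^+ 2.
Proof. by rewrite -!hdot_norm !hdotE; ring. Qed.

Lemma continuous_hdotl y : continuous (hdot^~ y : H -> R[i]^o).
Proof.
move=> x; apply/cvgrPdist_lt => e e0; near=> z.
rewrite -hdotBl (le_lt_trans (cauchy_schwarz _ _))//.
(* The added 1 keeps the divisor positive when [y = 0]. *)
rewrite (@le_lt_trans _ _ (`|x - z| * (`|y| + 1)))//.
  by rewrite ler_wpM2l ?normr_ge0 ?lerDl.
rewrite -ltr_pdivlMr ?ltr_wpDl//; near: z.
by apply: cvgr_dist_lt; rewrite ?divr_gt0 ?ltr_wpDl.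
Unshelve. all: by end_near. Qed.

End HilbertGeometry.

(* Existence of the adjoint of an isometry, vector by vector: [z] is the point
   at which [`|y - T x|] is minimal. *)
Lemma isometry_adjoint (R : realType) (E H : hilbertType R)
    (T : {linear E -> H}) (hT : forall x x', hdot (T x) (T x') = hdot x x')
    (y : H) : exists z, forall x, hdot (T x) y = hdot x z.
Proof.
have nT x : `|T x| = `|x|.
  by apply/eqP; rewrite -(@eqrXn2 _ 2) // -!hdot_norm hT.
pose f x := `|y - T x| ^+ 2.
have [D [D0 Df fD]] : exists D, [/\ 0 <= D, forall x, D <= f x &
    forall e, 0 < e -> exists x, f x < D + e].
  by apply: infC; [exact: 0|move=> x; rewrite exprn_ge0].
(* [D] is the infimum of [f], and [B n] consists of the points that come within [n.+1%:R^-1] of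
   it. *)
pose B n : set E := [set x | f x < D + n.+1%:R^-1].
have Bneq0 n : B n !=set0 by apply: fD; exact: invSn_gt0.
have Bmono m n : (m <= n)%N -> B n `<=` B m.
  by move=> mn x /lt_le_trans; apply; rewrite lerD2l invSn_le.
(* Parallelogram law for [y - T x] and [y - T x']: their sum is twice [y - T m] with [m] the
   midpoint, and [f m] is at least [D]. *)
have Bdist n x x' : B n x -> B n x' -> `|x - x'| ^+ 2 < 4 * n.+1%:R^-1.
  move=> Bx Bx'; pose m := 2^-1 *: (x + x').
  have := parallelogram (y - T x) (y - T x').
  have -> : y - T x + (y - T x') = 2 *: (y - T m).
    have -> : 2 *: (y - T m) = 2 *: y - (T x + T x').
      rewrite scalerBr -linearZ /m scalerA divff ?pnatr_eq0// scale1r.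
      by rewrite linearD.
    by rewrite scaler_nat mulr2n opprD addrACA.
  have -> : y - T x - (y - T x') = - T (x - x').
    by rewrite (raddfB T) !opprB addrC addrA subrK.
  rewrite normrN nT normrZ exprMn normr_nat => eq4.
  have := Df m; rewrite /f => Dm.
  have -> : `|x - x'| ^+ 2 = 2 * f x + 2 * f x' - 2 ^+ 2 * `|y - T m| ^+ 2.
    by rewrite -eq4 [RHS]addrC addKr.
  have -> : 4 * n.+1%:R^-1 =
      2 * (D + n.+1%:R^-1) + 2 * (D + n.+1%:R^-1) - 2 ^+ 2 * D :> R[i] by ring.
  by rewrite ltr_leD ?ltrD ?ltr_pM2l // lerN2 ler_pM2l // exprn_gt0.
have Bsmall (e : R[i]) : 0 < e ->
    exists n, forall x x', B n x -> B n x' -> `|x - x'| < e.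
  move=> e0; have e40 : 0 < e ^+ 2 / 4 by rewrite divr_gt0 ?exprn_gt0.
  have [n ne] := invSn_lt e40; exists n => x x' Bx Bx'.
  rewrite -ltr_sqr ?nnegrE ?(ltW e0) //.
  rewrite (lt_trans (Bdist n x x' Bx Bx')) //.
  by rewrite mulrC -ltr_pdivlMr.
have [z Bz] := nested_cvg Bneq0 Bmono Bsmall.
(* Moving [x] along [w] to the best point lowers [f] by [|hdot (y - T x) (T w)| ^+ 2 / |w| ^+ 2].
   This gain is at most [n.+1%:R^-1], since [f] cannot drop below [D]. *)
have orth_small n x w : B n x ->
    `|hdot (y - T x) (T w)| ^+ 2 <= `|w| ^+ 2 / n.+1%:R.
  have [->|w0] := eqVneq w 0.
    by rewrite linear0 hdot0r !normr0 expr0n /= mul0r.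
  have Tw0 : T w != 0 by rewrite -normr_eq0 nT normr_eq0.
  have w2 : 0 < `|w| ^+ 2 by rewrite exprn_gt0 ?normr_gt0.
  move=> Bx; have := Df (x + hdot (y - T x) (T w) / `|T w| ^+ 2 *: w).
  rewrite /f linearD linearZ /= opprD addrA hnorm_sub_line // nT => le.
  rewrite mulrC -ler_pdivrMr // -(lerD2l D).
  by apply: le_trans (ltW Bx); rewrite -lerBrDr.
(* Orthogonality at the limit [z] comes from nearby almost minimizers [x], by splitting [y - T z]
   into [y - T x] and [T (z - x)]. *)
suff orth w : hdot (y - T z) (T w) = 0.
  exists z => w; have /hdot_eq0C := orth w.
  by rewrite hdotBr hT => /eqP; rewrite subr_eq0 => /eqP.
apply: normr0_eq0; apply: eq0_lt => // e e0.
have e20 : 0 < e / 2 by rewrite divr_gt0.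
have w1 : 0 < `|w| + 1 by rewrite ltr_wpDl.
have [n1 Bn1] := Bz (e / 2 / (`|w| + 1)) (divr_gt0 e20 w1).
have [n2 n2e] := invSn_lt (exprn_gt0 2 (divr_gt0 e20 w1)).
have [x Bx] := Bneq0 (maxn n1 n2).
have {}n2e := le_lt_trans (invSn_le R (leq_maxr n1 n2)) n2e.
have {Bn1} zx := Bn1 x (Bmono _ _ (leq_maxl n1 n2) _ Bx).
have -> : y - T z = (y - T x) - T (z - x).
  by rewrite (raddfB T) opprB addrA subrK.
rewrite hdotBl (le_lt_trans (ler_normB _ _)) // [e]splitr ltrD //.
  rewrite -ltr_sqr ?nnegrE ?(ltW e20) // (le_lt_trans (orth_small _ _ w Bx)) //.
  apply: (@le_lt_trans _ _ ((`|w| + 1) ^+ 2 * (maxn n1 n2).+1%:R^-1)).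
    rewrite ler_wpM2r ?(ltW (invSn_gt0 _ _)) //.
    by rewrite ler_sqr ?nnegrE ?(ltW w1) // lerDl.
  by rewrite mulrC -ltr_pdivlMr ?exprn_gt0 // -expr_div_n.
rewrite (le_lt_trans (cauchy_schwarz _ _)) // !nT.
apply: (@le_lt_trans _ _ (`|z - x| * (`|w| + 1))).
  by rewrite ler_wpM2l ?lerDl.
by rewrite -ltr_pdivlMr.
Qed.

(** The projection is the adjoint of the inclusion of [S], which is an isometry from the Hilbert
    space [hsub]. *)
Lemma orthogonal_projection (R : realType) (H : hilbertType R) (S : set H)
    (hS : closed_submodule S) (x : H) :
  exists p, S p /\ forall y, S y -> hdot (x - p) y = 0.
Proof.
pose T : {linear hsub (SubspaceOf hS) -> H} := val.
have [p xp] := isometry_adjoint (T := T) (fun _ _ => erefl) x.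
exists (val p); split; first exact: (hsubP p).
move=> y Sy; have Py : y \in subspace_pred (SubspaceOf hS) by apply/asboolP.
apply: hdot_eq0C; rewrite hdotBr; apply/eqP; rewrite subr_eq0; apply/eqP.
exact: xp (HSub Py).
Qed.

(** Polarization: expanding the norm of [u + v] gives the real part of the inner product, and
    replacing [y] by ['i *: y] gives the imaginary part. *)
Lemma norm_isometry_hdot (R : realType) (E H : hilbertType R)
    (T : {linear E -> H}) (nT : forall x, `|T x| = `|x|) (x y : E) :
  hdot (T x) (T y) = hdot x y.
Proof.
have re u v : hdot (T u) (T v) + hdot (T v) (T u) = hdot u v + hdot v u.
  have : `|T (u + v)| ^+ 2 = `|u + v| ^+ 2 by rewrite nT.
  rewrite linearD -!hdot_norm !hdotE !hdot_norm !nT => eq_uv.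
  apply: (addrI (`|u| ^+ 2 + `|v| ^+ 2)).
  by apply: etrans (etrans eq_uv _); rewrite -!hdot_norm; ring.
have := re x ('i *: y); rewrite linearZ /= !hdotE conjCi => im.
have i0 : 'i != 0 :> R[i] by rewrite neq0Ci.
have {im} : hdot (T y) (T x) - hdot (T x) (T y) = hdot y x - hdot x y.
  by apply: (mulfI i0); rewrite !mulrBr addrC -mulNr im mulNr addrC.
move=> im; have := re x y => re_xy.
have two0 : 2 != 0 :> R[i] by rewrite pnatr_eq0.
apply: (mulfI two0).
transitivity (hdot (T x) (T y) + hdot (T y) (T x)
  - (hdot (T y) (T x) - hdot (T x) (T y))); first by ring.
by rewrite re_xy im; ring.
Qed.

(** * Central vectors and isometric intertwiners *)

Section Bimodules.
Variables (R : realType) (A : cstarType R) (Dou : max_tensor A (opalg A)).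
Implicit Types (E H : bimodule Dou) (B : set A).

(** The unit fixes every vector [bm_rep H d xi]; these span a dense subspace by non-degeneracy, and
    the set of fixed vectors is closed. *)
Lemma rep_cone H (x : H) : bm_rep H cone x = x.
Proof.
suff -> : [set x | bm_rep H cone x = x] x by [].
have : closed [set x | bm_rep H cone x = x :> H].
  by apply: closed_eq_fun; [exact: rep_bounded|move=> y; exact: cvg_id].
apply; apply/closure_normP => e e0.
have [_ [s [sP ->]] xs] := dense_norm (@bm_nondegenerate _ _ _ H) x e0.
exists (\sum_(p <- s) p.1 *: p.2) => //=.
rewrite linear_sum; apply: eq_big_seq => p /sP[d [xi ->]].
by rewrite linearZ /= -rep_mul cmul1x.
Qed.

Lemma central_closed_submodule H B : closed_submodule (central H B).
Proof.
split.
- by move=> b _; rewrite /lact /ract !linear0.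
- move=> c x y xc yc b Bb; rewrite /lact /ract !linearP /=.
  by congr (_ *: _ + _); [exact: xc|exact: yc].
- have -> : central H B = \bigcap_(b in B) [set x | lact b x = ract x b].
    by apply/seteqP; split.
  by apply: closed_bigI => b _; apply: closed_eq_fun; exact: rep_bounded.
Qed.

Lemma central_projP H B (x : H) : central H B (central_proj B x) /\
  forall y, central H B y -> hdot (x - central_proj B x) y = 0.
Proof.
exact: xgetPex (orthogonal_projection (central_closed_submodule H B) x).
Qed.

Lemma central_proj_unique H B (x p : H) : central H B p ->
  (forall y, central H B y -> hdot (x - p) y = 0) -> central_proj B x = p.
Proof.
move=> pc porth; have [qc qorth] := central_projP B x.
set q := central_proj B x in qc qorth *.
have rc : central H B (q - p).
  have [_ lin _] := central_closed_submodule H B.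
  by rewrite addrC -scaleN1r; exact: lin.
apply/eqP; rewrite -subr_eq0; apply/eqP; apply: hdot_self_eq0.
(* Both differences on the right are orthogonal to the central vector [q - p], which is therefore
   orthogonal to itself. *)
have {1}-> : q - p = (x - p) - (x - q) by rewrite opprB [RHS]addrC addrA subrK.
by rewrite hdotBl porth // qorth // subrr.
Qed.

Record intertwiner E H (T : {linear E -> H}) : Prop := Intertwiner {
  intertwiner_dot : forall x y, hdot (T x) (T y) = hdot x y ;
  intertwiner_rep : forall d x, T (bm_rep E d x) = bm_rep H d (T x)
}.

Section Intertwiners.
Variables (E H : bimodule Dou) (T : {linear E -> H}) (hT : intertwiner T).

Lemma intertwiner_norm x : `|T x| = `|x|.
Proof.
by apply/eqP; rewrite -(@eqrXn2 _ 2) // -!hdot_norm (intertwiner_dot hT).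
Qed.

Lemma intertwiner_comm a x :
  lact a (T x) - ract (T x) a = T (lact a x - ract x a).
Proof. by rewrite /lact /ract -!(intertwiner_rep hT) -raddfB. Qed.

Lemma intertwiner_central B x : central E B x <-> central H B (T x).
Proof.
split=> xc b Bb; apply/eqP; rewrite -subr_eq0.
  by rewrite intertwiner_comm xc // subrr linear0.
by rewrite -normr_eq0 -intertwiner_norm -intertwiner_comm xc // subrr normr0.
Qed.

Lemma intertwiner_almost_central Q beta x :
  almost_central_set E Q beta x <-> almost_central_set H Q beta (T x).
Proof.
rewrite /almost_central_set /= intertwiner_norm.
split=> -[x1 xQ]; split=> // a /xQ;
  by rewrite intertwiner_comm intertwiner_norm.
Qed.

(** The vector [z] is the adjoint of [T] applied to [y]. The adjoint also intertwines the actions,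
    because the representations respect [star], so it preserves centrality. *)
Lemma intertwiner_adjoint_central B y : central H B y ->
  exists2 z, central E B z & forall x, hdot (T x) y = hdot x z.
Proof.
move=> yc; have [z yz] := isometry_adjoint (intertwiner_dot hT) y.
exists z => // b Bb; apply/eqP; rewrite -subr_eq0; apply/eqP.
(* The commutator [w] of [z] with [b] is paired with itself; [adj] turns this into a pairing with
   the commutator of [y], which vanishes. *)
apply: hdot_self_eq0; set w := lact b z - _.
have adj d : hdot w (bm_rep E d z) = hdot (T w) (bm_rep H d y).
  have -> : d = star (star d) by rewrite starK.
  by rewrite -!rep_star -(intertwiner_rep hT) yz.
rewrite {2}/w hdotBr !adj -hdotBr.
by have := yc b Bb; rewrite /lact /ract => ->; rewrite subrr hdot0r.
Qed.

(** Pairing [T (x - p)] with a central [y] amounts to pairing [x - p] with the adjoint image of [y],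
    which is central in [E]. *)
Lemma intertwiner_proj B x : T (central_proj B x) = central_proj B (T x).
Proof.
have [pc porth] := central_projP B x.
apply/esym/central_proj_unique; first exact/intertwiner_central.
move=> y /intertwiner_adjoint_central[z zc yz].
by rewrite -raddfB yz porth.
Qed.

Lemma intertwiner_dist B x :
  `|T x - central_proj B (T x)| = `|x - central_proj B x|.
Proof. by rewrite -intertwiner_proj -raddfB intertwiner_norm. Qed.

End Intertwiners.
End Bimodules.

(** * Uniqueness of the GNS construction *)

Lemma rep_lt (R : realType) (D : cstarType R) (H : hilbertType R)
    (pi : star_rep D H) (d : D) (e : R[i]) : 0 < e ->
  exists2 c, 0 < c & forall x y, `|x - y| < c -> `|pi d x - pi d y| < e.
Proof.
move=> e0.
have /cvgrPdist_lt/(_ e e0)/nbhs_ballP[c /= c0 Hc] := @rep_bounded _ _ _ pi d 0.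
exists c => // x y xy.
rewrite -raddfB -normrN -[- _]add0r -{1}(linear0 (pi d)); apply: Hc.
by rewrite -ball_normE /= sub0r normrN.
Qed.

Section CyclicVectors.
Variables (R : realType) (D : cstarType R) (E H : hilbertType R).
Variables (rho : star_rep D E) (pi : star_rep D H) (x0 : E) (y0 : H).
Hypothesis eq_state : forall d, hdot (rho d x0) x0 = hdot (pi d y0) y0.
Hypothesis x0_cyclic : dense [set x | exists d, x = rho d x0].

(** The squared norm is the value of the common state at [cmul (star d) d]. *)
Let orbit_norm d : `|rho d x0| = `|pi d y0|.
Proof.
apply/eqP; rewrite -(@eqrXn2 _ 2) // -!hdot_norm -{2 4}[d]starK.
by rewrite -!rep_star -!rep_mul eq_state.
Qed.

(* The closure of the graph of [rho d x0 |-> pi d y0]. *)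
Let G (x : E) (y : H) := forall e : R[i], 0 < e ->
  exists d, `|x - rho d x0| < e /\ `|y - pi d y0| < e.

Let G_total x : exists y, G x y.
Proof.
pose B n : set H := [set y | exists d,
  y = pi d y0 /\ `|x - rho d x0| < n.+1%:R^-1].
have Bneq0 n : B n !=set0.
  have [_ [d ->] xd] := dense_norm x0_cyclic x (invSn_gt0 R n).
  by exists (pi d y0), d.
have Bmono m n : (m <= n)%N -> B n `<=` B m.
  move=> mn _ [d [-> xd]]; exists d; split=> //.
  exact: lt_le_trans xd (invSn_le R mn).
have [|y By] := nested_cvg Bneq0 Bmono.
  move=> e e0; have e20 : 0 < e / 2 by rewrite divr_gt0.
  have [n ne] := invSn_lt e20; exists n => _ _ [d [-> xd]] [d' [-> xd']].
  (* Differences of orbit points are again orbit points, so [orbit_norm] carries distances from [E]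
     to [H]. *)
  have repB (K : hilbertType R) (s : star_rep D K) z :
      s d z - s d' z = s (-1 *: d' + d) z.
    by rewrite rep_linear scaleN1r addrC.
  rewrite repB -orbit_norm -repB -(subrK x (rho d x0)) -addrA [e]splitr.
  rewrite (le_lt_trans (ler_normD _ _))// ltrD//; last exact: lt_trans ne.
  by rewrite distrC; apply: lt_trans ne.
exists y => e e0; have [n Bn] := By e e0; have [m me] := invSn_lt e0.
have [_ [d [_ xd]]] := Bneq0 (maxn m n); exists d; split.
  apply: lt_trans me; apply: lt_le_trans xd (invSn_le R _); exact: leq_maxl.
by apply: Bn; apply: (Bmono n (maxn m n)); [exact: leq_maxr|exists d].
Qed.

Let G_lin (c : R[i]) x x' y y' :
  G x y -> G x' y' -> G (c *: x + x') (c *: y + y').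
Proof.
move=> xy xy' e e0; have e20 : 0 < e / 2 by rewrite divr_gt0.
have c1 : 0 < `|c| + 1 by rewrite ltr_wpDl.
have [d [xd yd]] := xy _ (divr_gt0 e20 c1).
have [d' [xd' yd']] := xy' _ e20.
have small (V : normedModType R[i]) (u v u' v' : V) :
    `|u - v| < e / 2 / (`|c| + 1) -> `|u' - v'| < e / 2 ->
    `|c *: u + u' - (c *: v + v')| < e.
  move=> uv uv'; rewrite opprD addrACA -scalerBr [e]splitr.
  rewrite (le_lt_trans (ler_normD _ _))// ltrD// normrZ.
  rewrite (@le_lt_trans _ _ ((`|c| + 1) * `|u - v|))//.
    by rewrite ler_wpM2r ?lerDl.
  by rewrite mulrC -ltr_pdivlMr.
by exists (c *: d + d'); rewrite !rep_linear; split; apply: small.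
Qed.

Let G_norm x y : G x y -> `|x| = `|y|.
Proof.
move=> xy; apply/eqP; rewrite -subr_eq0 -normr_eq0; apply/eqP.
apply: eq0_lt => // e e0; have e20 : 0 < e / 2 by rewrite divr_gt0.
have [d [xd yd]] := xy _ e20.
rewrite -(subrK `|rho d x0| `|x|) -addrA {2}orbit_norm [e]splitr.
rewrite (le_lt_trans (ler_normD _ _))// ltrD//.
  exact: le_lt_trans (ler_dist_dist _ _) xd.
by rewrite distrC; exact: le_lt_trans (ler_dist_dist _ _) yd.
Qed.

Let G_rep a x y : G x y -> G (rho a x) (pi a y).
Proof.
move=> xy e e0.
have [c c0 rhoc] := rep_lt rho a e0; have [c' c'0 pic'] := rep_lt pi a e0.
have [c'' [c''0 c''c c''c']] := min_pos c0 c'0.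
have [d [xd yd]] := xy _ c''0; exists (cmul a d); rewrite !rep_mul; split.
  by apply: rhoc; exact: lt_le_trans xd c''c.
by apply: pic'; exact: lt_le_trans yd c''c'.
Qed.

(** Subtracting the two pairs relates 0 to [y' - y], and related vectors have equal norms. *)
Let G_fun x y y' : G x y -> G x y' -> y = y'.
Proof.
move=> xy xy'; have := G_norm (G_lin (-1) xy xy').
rewrite !scaleN1r addNr normr0 => /esym/normr0_eq0 /eqP.
by rewrite addrC subr_eq0 => /eqP.
Qed.

Let G_orbit d : G (rho d x0) (pi d y0).
Proof. by move=> e e0; exists d; rewrite !subrr !normr0. Qed.

(** [G] is total and single-valued, hence the graph of [T], which inherits linearity, isometry and
    equivariance from it. Only [x0] is cyclic, so [T] need not be onto. *)
Lemma cyclic_intertwiner : exists T : {linear E -> H},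
  [/\ forall x y, hdot (T x) (T y) = hdot x y,
      forall d x, T (rho d x) = pi d (T x) &
      forall d, T (rho d x0) = pi d y0].
Proof.
have [T GT] := choice G_total.
have Tlin : linear T by move=> c x y; apply: G_fun (G_lin c (GT x) (GT y)).
pose TM := GRing.isLinear.Build _ _ _ _ T Tlin.
pose T' : {linear E -> H} := HB.pack T TM.
exists T'; split=> [x y|d x|d].
- by apply: (norm_isometry_hdot (T := T')) => z; rewrite -(G_norm (GT z)).
- exact: G_fun (GT _) (G_rep d (GT x)).
- exact: G_fun (GT _) (G_orbit d).
Qed.

End CyclicVectors.

(** * Vector states and the universal bimodule *)

Section UniversalBimodule.
Variables (R : realType) (A : cstarType R) (Dou : max_tensor A (opalg A)).
Implicit Types (E H : bimodule Dou) (B : set A).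

Lemma vector_state H (x : H) : `|x| = 1 ->
  exists tau : state Dou, forall d, tau d = hdot (bm_rep H d x) x.
Proof.
move=> x1; pose f (d : Dou) : R[i] := hdot (bm_rep H d x) x.
have flin : linear_for *%R f.
  by move=> c d d'; rewrite /f rep_linear hdotDl hdotZl.
pose f' : {scalar Dou} := HB.pack f (GRing.isLinear.Build _ _ _ _ f flin).
have fpos d : 0 <= f' (cmul (star d) d).
  by rewrite /= /f rep_mul rep_star starK hdot_norm exprn_ge0.
have f1 : f' cone = 1 by rewrite /= /f rep_cone hdot_norm x1 expr1n.
by exists (State fpos f1).
Qed.

(** [E] is the summand of [Hu] for the vector state of [x], and [J] is its inclusion. Vectors of [H]
    are moved to [Hu] by way of [E]. *)
Lemma universal_bimodule_model (Hu : bimodule Dou)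
    (hHu : is_universal_bimodule Hu) H (x : H) : `|x| = 1 ->
  exists E (T : {linear E -> H}) (J : {linear E -> Hu}) (x0 : E),
    [/\ intertwiner T, intertwiner J & T x0 = x].
Proof.
move=> /vector_state[tau tauE]; have [M [gns [inc [incdot _ increp _]]]] := hHu.
have [x0 [x0tau x0cyc]] := gns tau.
have eq_state d : hdot (bm_rep (M tau) d x0) x0 = hdot (bm_rep H d x) x.
  by rewrite x0tau tauE.
have [T [Tdot Trep Tx0]] := cyclic_intertwiner eq_state x0cyc.
exists (M tau), T, (inc tau), x0; split=> //.
(* [Tx0] at the unit of the algebra gives [T x0 = x]. *)
by rewrite -[x0]rep_cone Tx0 rep_cone.
Qed.

End UniversalBimodule.

(** * Nets and almost central unit vectors *)

Section Nets.
Variables (I : Type) (le : I -> I -> Prop).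
Hypothesis le_directed : directed le.

Lemma tails_filter : ProperFilter (tails le).
Proof.
have [[i0] lexx le_trans le_join] := le_directed.
split.
  by case=> i /(_ i (lexx i)).
split.
- by exists i0.
- move=> P Q [i Pi] [j Qj]; have [k [ik jk]] := le_join i j.
  by exists k => l kl; split; [apply: Pi|apply: Qj]; exact: le_trans kl.
- by move=> P Q PQ [i Pi]; exists i => j /Pi /PQ.
Qed.

Lemma net_cvg0P (R : realType) (f : I -> R[i]) : (forall i, 0 <= f i) ->
  net_cvg0 le f <->
  forall e, 0 < e -> exists i0, forall i, le i0 i -> f i < e.
Proof.
move=> f0; have := tails_filter => FF; rewrite /net_cvg0.
have cvgP := @cvgrPdist_lt R[i] R[i]^o I (tails le) _ f 0.
split=> [/cvgP fcvg e /fcvg[i0 fi0]|fcvg].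
  by exists i0 => i /fi0; rewrite sub0r normrN ger0_norm.
apply/cvgP => e /fcvg[i0 fi0]; exists i0 => i /fi0 /=.
by rewrite sub0r normrN ger0_norm.
Qed.

Lemma net_finite (T : choiceType) (Q : set T) (P : T -> I -> Prop) :
  finite_set Q ->
  (forall x, Q x -> exists i0, forall i, le i0 i -> P x i) ->
  exists i0, forall i, le i0 i -> forall x, Q x -> P x i.
Proof.
move=> Qfin PQ; have := tails_filter => FF.
have : tails le (\bigcap_(x in Q) [set i | P x i]).
  have /finite_fsetP[X QX] := Qfin; rewrite QX; apply: filter_bigI => x xX.
  by apply: PQ; rewrite QX.
by move=> [i0 H]; exists i0 => i /H Hi x Qx; exact: Hi.
Qed.

End Nets.

Section AlmostCentralNets.
Variables (R : realType) (A : cstarType R) (Dou : max_tensor A (opalg A)).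
Implicit Types (E H : bimodule Dou) (B : set A).

Lemma almost_central_net_eventually H (I : Type) (le : I -> I -> Prop)
    (xi : I -> H) (Q : set A) (beta : R[i]) :
  almost_central_unit_vector le xi -> finite_set Q -> 0 < beta ->
  exists i0, forall i, le i0 i -> almost_central_set H Q beta (xi i).
Proof.
move=> [ledir xi1 xicvg] Qfin beta0.
have [i0 Hi0] : exists i0, forall i, le i0 i -> forall x, Q x ->
    `|lact x (xi i) - ract (xi i) x| < beta.
  apply: net_finite => // x _; move: (xicvg x).
  by move=> /(net_cvg0P ledir (fun=> normr_ge0 _)); apply.
by exists i0 => i /Hi0 Hi; split.
Qed.

(* Finite subsets of [A] and tolerances [n.+1%:R^-1], ordered by refinement. *)
Definition refines (p q : seq A * nat) : Prop :=
  {subset p.1 <= q.1} /\ (p.2 <= q.2)%N.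

Lemma refines_directed : directed refines.
Proof.
split=> [|p|p q r [pq pq'] [qr qr']|p q].
- exact: (inhabits ([::], 0)).
- by split.
- by split; [move=> x /pq /qr|exact: leq_trans qr'].
- exists (p.1 ++ q.1, maxn p.2 q.2); split; split=> /=.
  + by move=> x; rewrite mem_cat => ->.
  + exact: leq_maxl.
  + by move=> x; rewrite mem_cat orbC => ->.
  + exact: leq_maxr.
Qed.

(* The added [0], on which the condition is void, keeps the set nonempty. *)
Definition finite_part (p : seq A * nat) : set A := [set` 0 :: p.1].

Lemma finite_part_neq0 p : finite_part p !=set0.
Proof. by exists 0; rewrite /finite_part /= mem_head. Qed.

Lemma refines_almost_central H (xi : seq A * nat -> H) :
  (forall p, almost_central_set H (finite_part p) p.2.+1%:R^-1 (xi p)) ->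
  almost_central_unit_vector refines xi.
Proof.
move=> xiV; split=> [|p|a]; first exact: refines_directed.
  by have [] := xiV p.
apply/(net_cvg0P refines_directed (fun=> normr_ge0 _)) => e e0.
(* Beyond this index the finite set contains [a] and the tolerance is below [e]. *)
have [n ne] := invSn_lt e0; exists ([:: a], n) => q [aq nq].
have [_ xiq] := xiV q; apply: lt_trans ne; apply: lt_le_trans (invSn_le R nq).
by apply: xiq; rewrite /finite_part /= inE aq ?orbT// mem_head.
Qed.

End AlmostCentralNets.

(** * Subbimodules, and the one without central vectors *)

Section SubBimodule.
Variables (R : realType) (A : cstarType R) (Dou : max_tensor A (opalg A)).
Variables (H : bimodule Dou) (S : subspace_of H).
Hypothesis S_rep : forall d x, S x -> S (bm_rep H d x).

Let sub_rep_proof d (x : hsub S) : bm_rep H d (val x) \in subspace_pred S.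
Proof. by apply/asboolP/S_rep; exact: hsubP. Qed.

Definition sub_rep_fun d (x : hsub S) : hsub S := HSub (sub_rep_proof d x).

Fact sub_rep_linear d : linear (sub_rep_fun d).
Proof. by move=> c x y; apply: val_inj; rewrite /= !linearP. Qed.

HB.instance Definition _ d := GRing.isLinear.Build R[i] (hsub S) (hsub S) *:%R
  (sub_rep_fun d) (sub_rep_linear d).

Fact sub_rep_bounded d : continuous (sub_rep_fun d).
Proof.
apply: continuous_norm => e e0; have [c c0 Hc] := rep_lt (bm_rep H) d e0.
exists c => // x y xy; rewrite hsub_normE raddfB; apply: Hc.
by rewrite -raddfB.
Qed.

Definition sub_rep : star_rep Dou (hsub S).
Proof.
apply: (@StarRep _ _ _ (fun d => sub_rep_fun d)).
- exact: sub_rep_bounded.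
- by move=> c d e x; apply: val_inj; rewrite linearP /= rep_linear.
- by move=> d e x; apply: val_inj; rewrite /= rep_mul.
- by move=> d x y; exact: rep_star.
Defined.

(** The unit acts as the identity, so every vector is already in the range of the action. *)
Fact sub_rep_nondegenerate : nondegenerate_rep sub_rep.
Proof.
move=> O [x Ox] _; exists x; split=> //.
exists [:: (1, x)]; split=> [p|]; last by rewrite big_seq1 scale1r.
rewrite inE => /eqP -> /=; exists cone, x; apply: val_inj.
by rewrite /= rep_cone.
Qed.

Definition sub_bimodule : bimodule Dou := Bimodule sub_rep_nondegenerate.

Lemma sub_bimodule_intertwiner : intertwiner (val : {linear sub_bimodule -> H}).
Proof. by []. Qed.

End SubBimodule.

Section CentralFree.
Variables (R : realType) (A : cstarType R) (Dou : max_tensor A (opalg A)).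
Variables (H : bimodule Dou) (B : set A).

(** The orthogonal complement of the subbimodule generated by the central vectors. Ranging over all
    [d] makes it invariant under the action. *)
Definition central_free_set : set H :=
  [set x | forall d y, central H B y -> hdot x (bm_rep H d y) = 0].

Lemma central_free_closed_submodule : closed_submodule central_free_set.
Proof.
split.
- by move=> d y _; rewrite hdot0l.
- by move=> c x x' xK xK' d y yc; rewrite hdotDl hdotZl xK// xK'// mulr0 addr0.
- have -> : central_free_set = \bigcap_(p in [set p | central H B p.2])
      [set x | hdot x (bm_rep H p.1 p.2) = 0 :> R[i]^o].
    apply/seteqP; split=> [x xK [d y] /= yc|x xK d y yc]; first exact: xK.
    exact: (xK (d, y)).
  apply: closed_bigI => -[d y] _.
  by apply: closed_eq_fun; [exact: continuous_hdotl|move=> x; exact: cvg_cst].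
Qed.

Lemma central_free_rep d x :
  central_free_set x -> central_free_set (bm_rep H d x).
Proof. by move=> xK d' y yc; rewrite rep_star -rep_mul xK. Qed.

Definition central_free : bimodule Dou :=
  sub_bimodule (S := SubspaceOf central_free_closed_submodule) central_free_rep.

(** A vector that is central here is central in [H] too, so taking [d] to be the unit shows it
    orthogonal to itself. *)
Lemma central_central_free : central central_free B = [set 0].
Proof.
apply/seteqP; split=> [x xc|_ ->]; last first.
  by have [] := central_closed_submodule central_free B.
have /(intertwiner_central (sub_bimodule_intertwiner _)) xc' := xc.
apply: val_inj; apply: hdot_self_eq0; rewrite -{2}[val x]rep_cone.
exact: (hsubP x).
Qed.

(* The projection of a central vector onto [J(E)] is central, hence zero. *)
Lemma intertwiner_central_free (E : bimodule Dou) (J : {linear E -> H}) x :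
  intertwiner J -> central E B = [set 0] -> central_free_set (J x).
Proof.
move=> hJ E0 d y /(intertwiner_adjoint_central hJ)[z zc yz].
rewrite -[d]starK -rep_star -(intertwiner_rep hJ) yz.
by move: zc; rewrite E0 => ->; rewrite hdot0r.
Qed.

End CentralFree.

(** * Characterizations of property (T) and of its strong form by almost central nets *)

Theorem proposition2p4 (R : realType) (A : cstarType R) (B : set A)
    (hB : cstar_subalgebra B) (hB1 : B cone)
    (Dou : max_tensor A (opalg A))
    (Hu : bimodule Dou) (hHu : is_universal_bimodule Hu) :
  (property_T Dou B <->
     forall H : bimodule Dou,
       (exists (I : Type) (le : I -> I -> Prop) (xi : I -> H),
          almost_central_unit_vector le xi) ->
       central H B <> [set 0])
  /\
  ((strong_property_T Dou B <->
      forall (H : bimodule Dou) (I : Type) (le : I -> I -> Prop) (xi : I -> H),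
        almost_central_unit_vector le xi ->
        net_cvg0 le (fun i => `|xi i - central_proj B (xi i)|))
   /\
   (strong_property_T Dou B <->
      forall (I : Type) (le : I -> I -> Prop) (xi : I -> Hu),
        almost_central_unit_vector le xi ->
        forall n : nat, (0 < n)%N ->
          exists i_n : I,
            `|xi i_n - central_proj B (xi i_n)| < n%:R^-1)).
Proof.
have strong_cvg : strong_property_T Dou B ->
    forall (H : bimodule Dou) (I : Type) (le : I -> I -> Prop) (xi : I -> H),
    almost_central_unit_vector le xi ->
    net_cvg0 le (fun i => `|xi i - central_proj B (xi i)|).
  move=> sT H I le xi xiV; have [ledir _ _] := xiV.
  apply/(net_cvg0P ledir (fun=> normr_ge0 _)) => alpha.
  move=> /sT[Q [beta [Qfin _ beta0 QV]]].
  have [i0 xiQ] := almost_central_net_eventually xiV Qfin beta0.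
  by exists i0 => i /xiQ /QV.
have cvg_ex : (forall (H : bimodule Dou) (I : Type) (le : I -> I -> Prop)
      (xi : I -> H), almost_central_unit_vector le xi ->
    net_cvg0 le (fun i => `|xi i - central_proj B (xi i)|)) ->
    forall (I : Type) (le : I -> I -> Prop) (xi : I -> Hu),
    almost_central_unit_vector le xi ->
    forall n : nat, (0 < n)%N ->
      exists i_n : I, `|xi i_n - central_proj B (xi i_n)| < n%:R^-1.
  move=> cvg I le xi xiV n n0; have [ledir _ _] := xiV.
  have n1 : 0 < n%:R^-1 :> R[i] by rewrite invr_gt0 ltr0n.
  have := cvg _ _ _ _ xiV.
  move=> /(net_cvg0P ledir (fun=> normr_ge0 _))/(_ _ n1)[i0 Hi0].
  (* The threshold index itself serves, by reflexivity of [le]. *)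
  by exists i0; apply: Hi0; case: ledir.
have ex_strong : (forall (I : Type) (le : I -> I -> Prop) (xi : I -> Hu),
    almost_central_unit_vector le xi ->
    forall n : nat, (0 < n)%N ->
      exists i_n : I, `|xi i_n - central_proj B (xi i_n)| < n%:R^-1) ->
    strong_property_T Dou B.
  move=> Hex alpha alpha0; apply: contrapT => nT.
  (* If some [p] had no such vector in [Hu], its finite set and tolerance would witness strong
     property (T) for [alpha]: a bad vector of any [H] moves to [Hu] with the same commutator norms
     and the same distance. *)
  have bad p : exists zeta : Hu,
      almost_central_set Hu (finite_part p) p.2.+1%:R^-1 zeta /\
      ~ `|zeta - central_proj B zeta| < alpha.
    apply: contrapT => np; apply: nT; exists (finite_part p), p.2.+1%:R^-1.
    split; [exact: finite_seq|exact: finite_part_neq0|exact: invSn_gt0|].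
    move=> H xi xiV; have [xi1 _] := xiV.
    have [E [T [J [x0 [hT hJ Tx0]]]]] := universal_bimodule_model hHu xi1.
    apply: contrapT => nlt; apply: np; exists (J x0); split.
      apply/(intertwiner_almost_central hJ)/(intertwiner_almost_central hT).
      by rewrite Tx0.
    by rewrite (intertwiner_dist hJ) -(intertwiner_dist hT) Tx0.
  have [zeta zetaP] := choice bad.
  have zetaV : almost_central_unit_vector (@refines R A) zeta.
    by apply: refines_almost_central => p; have [] := zetaP p.
  have [n ne] := invSn_lt alpha0.
  have [p zp] := Hex _ _ _ zetaV n.+1 isT.
  by have [_] := zetaP p; apply; exact: lt_trans ne.
split; last first.
  split; first by split=> // cvg; exact/ex_strong/cvg_ex.
  by split=> // sT; exact/cvg_ex/strong_cvg.
split=> [[F [eps [Ffin _ eps0 FP]]] H [I [le [xi xiV]]]|noT].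
  apply: FP; have [i0 xiF] := almost_central_net_eventually xiV Ffin eps0.
  by exists (xi i0); apply: xiF; have [[]] := xiV.
apply: contrapT => nT.
(* Otherwise [p] would witness property (T): an almost central vector in some [H] without nonzero
   central vectors moves through [E] into [central_free Hu B]. *)
have bad p : exists zeta : central_free Hu B,
    almost_central_set (central_free Hu B) (finite_part p) p.2.+1%:R^-1 zeta.
  apply: contrapT => np; apply: nT; exists (finite_part p), p.2.+1%:R^-1.
  split; [exact: finite_seq|exact: finite_part_neq0|exact: invSn_gt0|].
  move=> H [xi xiV] H0; have [xi1 _] := xiV.
  have [E [T [J [x0 [hT hJ Tx0]]]]] := universal_bimodule_model hHu xi1.
  (* [T] is injective and sends central vectors to central vectors of [H], which are zero. *)
  have E0 : central E B = [set 0].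
    apply/seteqP; split=> [x /(intertwiner_central hT)|_ ->].
      rewrite H0 => Tx; apply: normr0_eq0.
      by rewrite -(intertwiner_norm hT) Tx normr0.
    by have [] := central_closed_submodule E B.
  have Jx0 := intertwiner_central_free x0 hJ E0.
  have Jx0_pred : J x0 \in
      subspace_pred (SubspaceOf (central_free_closed_submodule Hu B)).
    exact/asboolP.
  apply: np; exists (HSub Jx0_pred).
  apply/(intertwiner_almost_central (sub_bimodule_intertwiner _)).
  apply/(intertwiner_almost_central hJ)/(intertwiner_almost_central hT).
  by rewrite Tx0.
have [zeta zetaV] := choice bad.
apply: (noT (central_free Hu B)); last exact: central_central_free.
exists (seq A * nat)%type, (@refines R A), zeta.
exact: refines_almost_central.
Qed.
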